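(* Let $G=(\mathcal H,\mathcal V)$ be a two-dimensional graph on a finite vertex set, with adjacency matrices $H$ and $V$, and let $X_G$ be the two-dimensional shift space generated by $G$. Suppose that for all vertices $i,j$ one has $(HV)_{ij}\neq 0 \Leftrightarrow (VH)_{ij}\neq 0$. Then $X_G$ is horizontally doubly transitive if and only if $H_k$ is irreducible for all $k\in\mathbb N$.
   Context: A two-dimensional graph $G=(\mathcal H,\mathcal V)$ is a pair of finite directed graphs (loops allowed, no multiple edges) on a common vertex set $A$, with $0$-$1$ adjacency matrices $H$ (for $\mathcal H$) and $V$ (for $\mathcal V$). It generates $X_G=\{x\in A^{\mathbb Z^2}: H_{x(m,n)\,x(m+1,n)}=1 \text{ and } V_{x(m,n)\,x(m,n+1)}=1 \text{ for all } (m,n)\in\mathbb Z^2\}$, with the subspace topology of the product topology on $A^{\mathbb Z^2}$ ($A$ discrete). Shift spaces (subshifts) are by definition non-empty, closed and shift-invariant. For $a\in\mathbb Z^2$, $(\sigma^a x)(k)=x(k+a)$. $Q_k$ is the set of valid $k\times 1$ patterns (vertical columns $(c_1,\dots,c_k)\in A^k$, read from bottom to top, with $V_{c_tc_{t+1}}=1$ for $1\le t<k$), and $H_k$ is the $0$-$1$ matrix indexed by $Q_k$ recording horizontal compatibility: $(H_k)_{c,d}=1$ iff $H_{c_td_t}=1$ for all $1\le t\le k$. In particular $H_1=H$. $X_G$ is horizontally doubly transitive if both $\sigma^{(1,0)}$ and $\sigma^{(-1,0)}$ are transitive for positive time: for any non-empty open $U,W\subseteq X_G$ there are $p,q\in\mathbb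 N=\{1,2,\dots\}$ with $\sigma^{(p,0)}(U)\cap W\neq\emptyset$ and $\sigma^{(-q,0)}(U)\cap W\neq\emptyset$. A non-negative square matrix $M$ is irreducible if for every pair of indices $i,j$ there is $k\in\mathbb N$ with $(M^k)_{ij}\neq 0$.
   Formalization: The direction from horizontally doubly transitive to all H_k irreducible is stated only for graphs where every vertex has an incoming and an outgoing edge in both graphs; it fails otherwise (two vertices, both graphs having a single loop at the same vertex). The converse is unrestricted. *)

(* Defs.v *)
From HB Require Import structures.
From mathcomp Require Import all_boot all_order all_algebra.
From mathcomp Require Import boolp classical_sets topology.

Set Implicit Arguments.
Unset Strict Implicit.
Unset Printing Implicit Defensive.

Import GRing.Theory.

Local Open Scope classical_set_scope.
Local Open Scope ring_scope.

(* Without multiple edges, a finite directed graph on [A] is a relation on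
   [A]. *)
Record graph2 (A : finType) := Graph2 { hedge : rel A; vedge : rel A }.

(* MathComp matrices are indexed by ordinals, so the rows and columns of the
   adjacency matrix of a relation on [T] are numbered by [enum_val]. *)
Definition adjmx (T : finType) (e : rel T) : 'M[nat]_#|T| :=
  \matrix_(i, j) nat_of_bool (e (enum_val i) (enum_val j)).

(* The exponent is required to be positive: for instance the 1 x 1 zero matrix
   is not irreducible. *)
Definition irreducible_mx n (M : 'M[nat]_n) : Prop :=
  forall i j, exists2 k : nat, (0 < k)%N & (M ^+ k) i j != 0.

Section TwoDimensionalShift.
Variable A : finType.

Definition config := {ptws int * int -> discrete_topology A}.

Definition shift (a : int * int) (x : config) : config := fun k => x (k + a).

Definition hor_doubly_transitive (X : set config) : Prop :=
  forall U W : set (subspace X),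
    U `<=` X -> W `<=` X -> open U -> open W -> U !=set0 -> W !=set0 ->
    exists p q : nat, [/\ (0 < p)%N, (0 < q)%N,
      shift (p%:Z, 0) @` U `&` W !=set0 &
      shift (- q%:Z, 0) @` U `&` W !=set0].

Variable G : graph2 A.

Definition Hmx : 'M[nat]_#|A| := adjmx (hedge G).

Definition Vmx : 'M[nat]_#|A| := adjmx (vedge G).

Definition XG : set config :=
  [set x | forall m n : int, hedge G (x (m, n)) (x (m + 1, n)) /\
                             vedge G (x (m, n)) (x (m, n + 1))].

(* Columns are listed from bottom to top; [sorted r s] only requires [r]
   between consecutive entries of [s]. *)
Definition column (k : nat) : finType :=
  {c : k.-tuple A | sorted (vedge G) c}.

Definition hcompat (k : nat) : rel (column k) := fun c d =>
  [forall t : 'I_k, hedge G (tnth (val c) t) (tnth (val d) t)].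

Definition Hk (k : nat) : 'M[nat]_#|column k| := adjmx (@hcompat k).

(* Neither graph has a stranded vertex (a source or a sink). *)
Definition essential : Prop :=
  forall a : A,
    [/\ exists b, hedge G a b, exists b, hedge G b a,
        exists b, vedge G a b & exists b, vedge G b a].

End TwoDimensionalShift.

(* Main.v *)
Require Import Defs.
From mathcomp Require Import all_boot all_order all_algebra.
From mathcomp Require Import boolp classical_sets topology.
From mathcomp Require Import zify.

Import Order.TTheory GRing.Theory.

(** The hypothesis on [HV] and [VH] says that a horizontal edge followed by
    a vertical one can be replaced by a vertical edge followed by a horizontal
    one between the same vertices, and conversely. Read in the plane, a missing
    upper left corner of a unit square can be filled in when the other three
    vertices are admissible, and so can a missing lower right corner. The other
    two kinds of corners need not be fillable.

    Consequently, an admissible pattern on a region whose complement is the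
    union of a part [U] closed under steps left and up and a part [L] closed
    under steps right and down extends to the whole plane ([completion]):
    [U] is filled with upper left corners in the order of increasing [n - m],
    and [L] symmetrically. Typically, [U] and [L] are the parts of the plane
    on the two sides of a staircase that climbs from lower left to upper right;
    each implication uses one such decomposition.

    If all [H_k] are irreducible, let [x] and [y] be points of the shift to be
    approximated on the box of radius [N]. A walk in the graph of [H_(2N+1)]
    joins the right edge of the box in [x] to the left edge of the box in
    [y], which gives an admissible strip of height [2N+1] following [x] on the
    left and a translate of [y] on the right. Adding to the strip everything
    that [x] has below its left end and everything that [y] has above its right
    end yields a region of the required shape ([glue_strip]).

    Conversely, transitivity applied to the cylinders of two columns [c] and
    [d] gives a point of the shift whose successive columns form a walk from
    [c] to [d]. The cylinders are non-empty because any column lies on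
    a bi-infinite staircase, made of edges that exist since there are no
    stranded vertices; the staircase is then completed ([column_in_XG]). *)

Local Open Scope classical_set_scope.
Local Open Scope ring_scope.

(** * Filling corners of the plane *)

(** Well-founded recursion on a rank, delivered as an equation. The iterate
    number [t] of [step] is already final at all points of rank below [t]. *)
Lemma rank_recursion {T B : Type} (r : T -> nat) (step : T -> (T -> B) -> B)
    (F0 : T -> B) :
  (forall p F F', (forall q, (r q < r p)%N -> F q = F' q) ->
    step p F = step p F') ->
  exists F, forall p, F p = step p F.
Proof.
move=> stepP; pose f t := iter t (fun F p => step p F) F0.
have fE t s p : (r p < t)%N -> (r p < s)%N -> f t p = f s p.
  elim: t s p => [//|t IH] [//|s] p pt ps /=.
  by apply: stepP => q qp; apply: IH; lia.
exists (fun p => f (r p).+1 p) => p /=.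
by apply: stepP => q qp; apply: (fE (r p) (r q).+1).
Qed.

Definition admissible {A : Type} (h v : rel A) (D : int -> int -> bool)
    (x : int -> int -> A) : Prop :=
  (forall m n, D m n -> D (m + 1) n -> h (x m n) (x (m + 1) n)) /\
  (forall m n, D m n -> D m (n + 1) -> v (x m n) (x m (n + 1))).

(** Here [a], [b] and [c] sit at the lower left, lower right and upper right of
    a unit square whose upper left corner [d] is missing. Exchanging [h] and [v]
    reflects the picture: the missing corner is then the lower right one. *)
Definition square_completing {A : Type} (h v : rel A) : Prop :=
  forall a b c, h a b -> v b c -> exists2 d, v a d & h d c.

Lemma XG_admissible {A : finType} (G : graph2 A) (x : config A) :
  XG G x <-> admissible (hedge G) (vedge G) (fun _ _ => true)
               (fun m n => x (m, n)).
Proof.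
split=> [xG|[xh xv] m n]; last by split; [apply: xh|apply: xv].
by split=> m n _ _; case: (xG m n).
Qed.

(** The value at a point of [U] is chosen from the values at its right and lower
    neighbours, for which [n - m] is smaller. The choice is possible because
    both neighbours are joined by an edge to the lower right diagonal point:
    if the neighbour lies in [U], this edge was obtained at an earlier stage;
    if it lies in [D], so does the diagonal point, as [U] is closed under steps
    left and up, and the edge is given. *)
Lemma fill_upper_left {A : finType} (h v : rel A) (D U : int -> int -> bool)
    (C : int) (x : int -> int -> A) :
  square_completing h v ->
  (forall m n, U m n -> [/\ U (m - 1) n, U m (n + 1) & C < n - m]) ->
  (forall m n, U m n -> ~~ D m n) ->
  (forall m n, U m n -> [/\ D (m + 1) n || U (m + 1) n,
     D m (n - 1) || U m (n - 1) & D (m + 1) (n - 1) || U (m + 1) (n - 1)]) ->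
  admissible h v D x ->
  exists2 y, (forall m n, ~~ U m n -> y m n = x m n) &
    admissible h v (fun m n => D m n || U m n) y.
Proof.
move=> sq Ucl UD Unb [xh xv].
(* Points outside [U] get rank 0; the bound [C] makes all ranks in [U]
   positive. *)
pose r (p : int * int) := if U p.1 p.2 then absz (p.2 - p.1 - C)%R else 0%N.
pose step (p : int * int) (F : int * int -> A) :=
  if U p.1 p.2 then
    odflt (x p.1 p.2)
      [pick z | v (F (p.1, p.2 - 1)) z && h z (F (p.1 + 1, p.2))]
  else x p.1 p.2.
have rlt m n q : U m n ->
    q = (m, n - 1) \/ q = (m + 1, n) -> (r q < r (m, n))%N.
  move=> Up; have [_ _ Cp] := Ucl _ _ Up.
  rewrite /r /= Up => -[] -> /=; case: ifP => [/Ucl[_ _]|_]; lia.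
have [|F FE] := rank_recursion r step (fun p => x p.1 p.2).
  move=> [m n] F F' FF'; rewrite /step /=; case: ifP => // Up.
  by rewrite !FF' //; apply: rlt; auto.
exists (fun m n => F (m, n)) => [m n /negPf Un|].
  by rewrite FE /step /= Un.
have FD m n : D m n -> F (m, n) = x m n.
  move=> Dp; rewrite FE /step /=; case: ifP => // /UD.
  by rewrite Dp.
have key : forall t m n, U m n -> (r (m, n) < t)%N ->
    v (F (m, n - 1)) (F (m, n)) && h (F (m, n)) (F (m + 1, n)).
  elim=> [//|t IH] m n Up rt.
  have [Ucl1 Ucl2 _] := Ucl _ _ Up.
  have [nE nS nSE] := Unb _ _ Up.
  have hS : h (F (m, n - 1)) (F (m + 1, n - 1)).
    case/orP: nS => [DS|US].
      have DSE : D (m + 1) (n - 1).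
        case/orP: nSE => // /Ucl[]; rewrite addrK => /UD.
        by rewrite DS.
      by rewrite !FD //; apply: xh.
    have := rlt _ _ _ Up (or_introl erefl) => lt.
    by case/andP: (IH m (n - 1) US (leq_trans lt rt)).
  have vE : v (F (m + 1, n - 1)) (F (m + 1, n)).
    case/orP: nE => [DE|UE].
      have DSE : D (m + 1) (n - 1).
        case/orP: nSE => // /Ucl[_]; rewrite subrK => /UD.
        by rewrite DE.
      rewrite !FD //; have := xv (m + 1) (n - 1).
      by rewrite subrK; apply.
    have := rlt _ _ _ Up (or_intror erefl) => lt.
    by case/andP: (IH (m + 1) n UE (leq_trans lt rt)).
  have [d vd hd] := sq _ _ _ hS vE.
  rewrite [F (m, n)]FE /step /= Up.
  by case: pickP => [//|/(_ d)]; rewrite vd hd.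
have {}key m n : U m n -> v (F (m, n - 1)) (F (m, n)) /\
    h (F (m, n)) (F (m + 1, n)).
  by move=> Up; apply/andP/(key _ _ _ Up (leqnn _)).
split=> m n p1 p2.
  have [/key[]//|Un] := boolP (U m n).
  have [/Ucl[]|Un'] := boolP (U (m + 1) n).
    by rewrite addrK (negPf Un).
  rewrite (negPf Un) (negPf Un') !orbF in p1 p2.
  by rewrite !FD //; apply: xh.
have [/key[]|Un'] := boolP (U m (n + 1)); first by rewrite addrK.
have [/Ucl[_]|Un] := boolP (U m n); first by rewrite (negPf Un').
rewrite (negPf Un) (negPf Un') !orbF in p1 p2.
by rewrite !FD //; apply: xv.
Qed.

(** The two parts are filled one after the other. [L] must not even contain the
    lower right diagonal neighbour of a point of [U], so that no square used to
    fill [U] has a vertex in [L]; when [L] is filled, everything else is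
    known. *)
Lemma completion {A : finType} (h v : rel A) (U L : int -> int -> bool)
    (C : int) (x : int -> int -> A) :
  square_completing h v -> square_completing v h ->
  (forall m n, U m n -> [/\ U (m - 1) n, U m (n + 1) & C < n - m]) ->
  (forall m n, L m n -> [/\ L (m + 1) n, L m (n - 1) & C < m - n]) ->
  (forall m n, U m n -> ~~ L (m + 1) (n - 1)) ->
  admissible h v (fun m n => ~~ U m n && ~~ L m n) x ->
  exists2 y, (forall m n, ~~ U m n -> ~~ L m n -> y m n = x m n) &
    admissible h v (fun _ _ => true) y.
Proof.
move=> sq sq' Ucl Lcl UL xadm.
have UE m n : U m n -> ~~ L (m + 1) n.
  by move=> Up; apply: contra (UL _ _ Up) => /Lcl[].
have US m n : U m n -> ~~ L m (n - 1).
  by move=> Up; apply: contra (UL _ _ Up) => /Lcl[].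
have [||y yx [yh yv]] := fill_upper_left h v
    (fun m n => ~~ U m n && ~~ L m n) U C x sq Ucl _ _ xadm.
- by move=> m n ->.
- move=> m n Up; rewrite UE // US // UL // !andbT.
  by split; case: (U _ _).
(* Reflection in the diagonal exchanges the two kinds of corners. *)
have [|||| z zy [zv zh]] := fill_upper_left v h
    (fun n m => ~~ L m n) (fun n m => L m n) C (fun n m => y m n) sq'.
- by move=> n m /Lcl[].
- by move=> n m ->.
- by move=> n m _; split; case: (L _ _).
- split=> n m p1 p2; [apply: yv|apply: yh]; rewrite ?p1 ?p2 ?andbT;
    by case: (U _ _).
exists (fun m n => z n m) => [m n Un Ln|].
  by rewrite zy // yx.
by split=> m n _ _; [apply: zh|apply: zv]; case: (L _ _).
Qed.

(** * Walks and adjacency matrices *)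

Lemma mulmx_nat_neq0 {m n p} (M : 'M[nat]_(m, n)) (N : 'M[nat]_(n, p)) i j :
  (M *m N) i j != 0 <-> exists2 l, M i l != 0 & N l j != 0.
Proof.
have mul_eq0 l : (M i l * N l j == 0) = (M i l == 0) || (N l j == 0).
  exact: muln_eq0.
rewrite mxE; split=> [|[l Ml Nl]].
  apply: contraNP => noL; rewrite sum_nat_eq0; apply/forallP => l /=.
  rewrite mul_eq0; apply/negPn; rewrite negb_or; apply/negP => /andP[Ml Nl].
  by apply: noL; exists l.
rewrite sum_nat_eq0; apply/forallPn; exists l.
by rewrite /= mul_eq0 negb_or Ml.
Qed.

Lemma adjmx_neq0 {T : finType} (e : rel T) i j :
  (adjmx e i j != 0) = e (enum_val i) (enum_val j).
Proof. by rewrite mxE; case: e. Qed.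

Lemma adjmx_mul_neq0 {T : finType} (e f : rel T) i j :
  (adjmx e *m adjmx f) i j != 0 <->
  exists2 b, e (enum_val i) b & f b (enum_val j).
Proof.
rewrite mulmx_nat_neq0; split=> [[l]|[b eb fb]].
  by rewrite !adjmx_neq0; exists (enum_val l).
by exists (enum_rank b); rewrite adjmx_neq0 enum_rankK.
Qed.

Lemma adjmx_exp_neq0 {T : finType} (e : rel T) (k : nat) i j :
  (adjmx e ^+ k) i j != 0 <->
  exists f : nat -> T, [/\ f 0%N = enum_val i, f k = enum_val j &
    forall t, (t < k)%N -> e (f t) (f t.+1)].
Proof.
elim: k i => [|k IH] i.
  rewrite expr0 mxE; split=> [|[f [f0 f0' _]]].
    by case: (i =P j) => [-> _|//]; exists (fun=> enum_val j).
  by rewrite (enum_val_inj (etrans (esym f0) f0')) eqxx.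
rewrite exprS -mulmxE mulmx_nat_neq0; split=> [[l]|[f [f0 fk fe]]].
  rewrite adjmx_neq0 => el /IH[f [f0 fk fe]].
  exists (fun t => if t is t'.+1 then f t' else enum_val i); split=> //.
  by case=> [_|t /fe//]; rewrite f0.
exists (enum_rank (f 1%N)).
  by rewrite adjmx_neq0 enum_rankK -f0; apply: fe.
apply/IH; exists (f \o succn); rewrite enum_rankK; split=> // t tk.
exact: fe.
Qed.

Lemma square_completing_adjmx {A : finType} (h v : rel A) :
  (forall i j, (adjmx h *m adjmx v) i j != 0 ->
     (adjmx v *m adjmx h) i j != 0) ->
  square_completing h v.
Proof.
move=> hv a b c hab vbc.
have /hv/adjmx_mul_neq0[] :
    (adjmx h *m adjmx v) (enum_rank a) (enum_rank c) != 0.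
  by apply/adjmx_mul_neq0; exists b; rewrite enum_rankK.
by rewrite !enum_rankK => d; exists d.
Qed.

Section Columns.
Context {A : finType} (G : graph2 A) (k : nat).

Lemma hcompatP (a : A) (c d : column G k) :
  reflect (forall i, (i < k)%N ->
             hedge G (nth a (val c) i) (nth a (val d) i))
          (hcompat c d).
Proof.
apply: (iffP forallP) => [cd i ik|cd i].
  by have := cd (Ordinal ik); rewrite !(tnth_nth a).
by rewrite !(tnth_nth a); apply: cd.
Qed.

Lemma column_vedge (a : A) (c : column G k) i : (i.+1 < k)%N ->
  vedge G (nth a (val c) i) (nth a (val c) i.+1).
Proof. by move=> ik; move/sortedP: (valP c); apply; rewrite size_tuple. Qed.

Lemma column_of (a : A) (u : nat -> A) :
  (forall i, (i.+1 < k)%N -> vedge G (u i) (u i.+1)) ->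
  exists c : column G k, forall i, (i < k)%N -> nth a (val c) i = u i.
Proof.
move=> uv; have srt : sorted (vedge G) [tuple of mkseq u k].
  apply/(sortedP a) => i; rewrite /= size_mkseq => ik.
  by rewrite !nth_mkseq //; [apply: uv|apply: ltnW].
exists (exist (fun c : k.-tuple A => sorted (vedge G) c) _ srt) => i ik /=.
by rewrite nth_mkseq.
Qed.

(** A walk of length [l] in the graph of [H_k], seen as an admissible pattern of
    width [l + 1] and height [k]. Functions on [nat] make such patterns easy to
    exchange with parts of plane configurations. *)
Lemma Hk_exp_neq0 (a : A) (c d : column G k) l :
  (Hk G k ^+ l) (enum_rank c) (enum_rank d) != 0 <->
  exists f : nat -> nat -> A,
   [/\ forall i, (i < k)%N -> f 0%N i = nth a (val c) i,
       forall i, (i < k)%N -> f l i = nth a (val d) i,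
       forall t i, (t < l)%N -> (i < k)%N -> hedge G (f t i) (f t.+1 i) &
       forall t i, (t <= l)%N -> (i.+1 < k)%N -> vedge G (f t i) (f t i.+1)].
Proof.
rewrite adjmx_exp_neq0 !enum_rankK; split.
  case=> f [f0 fl fe]; exists (fun t => nth a (val (f t))); rewrite f0 fl.
  split=> // [t i /fe/(hcompatP a)|t i _]; first exact.
  exact: column_vedge.
case=> f [f0 fl fh fv].
have /choice[g gE] : forall t, exists e : column G k,
    (t <= l)%N -> forall i, (i < k)%N -> nth a (val e) i = f t i.
  move=> t; case: (leqP t l) => [tl|_]; last by exists c.
  by have [e eE] := column_of a (f t) (fv t ^~ tl); exists e.
have colP (e e' : column G k) :
    (forall i, (i < k)%N -> nth a (val e) i = nth a (val e') i) -> e = e'.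
  move=> ee'; apply/val_inj/val_inj/(@eq_from_nth _ a).
    by rewrite !size_tuple.
  by rewrite size_tuple.
exists g; split.
- by apply: colP => i ik; rewrite gE // f0.
- by apply: colP => i ik; rewrite gE // fl.
- move=> t tl; apply/(hcompatP a) => i ik.
  by rewrite !gE // ?(ltnW tl) //; apply: fh.
Qed.
End Columns.

(** * Cylinders in the product topology *)

Lemma open_cylinder {A : finType} (s : seq (int * int)) (x : config A) :
  open [set y : config A | forall p, p \in s -> y p = x p].
Proof.
elim: s => [|p s IH].
  by rewrite (_ : [set _ | _] = setT) ?eqEsubset; [exact: openT|split].
rewrite (_ : [set _ | _] = (fun y : config A => y p) @^-1` [set x p] `&`
    [set y : config A | forall p, p \in s -> y p = x p]).
  apply: openI IH; apply: open_comp; last exact: discrete_open.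
  move=> y _.
  exact: (@proj_continuous _ (fun=> discrete_topology A) p).
apply/seteqP; split=> y /= => [yx|[yp ys] q].
  by split=> [|q qs]; apply: yx; rewrite inE ?eqxx ?qs ?orbT.
by rewrite inE => /orP[/eqP->|/ys].
Qed.

(** The cylinders around [x] generate a filter which converges to [x] in every
    coordinate, hence in the product topology. *)
Lemma nbhs_cylinder {A : finType} (x : config A) (U : set (config A)) :
  nbhs x U -> exists s : seq (int * int),
    forall y : config A, (forall p, p \in s -> y p = x p) -> U y.
Proof.
pose B (s : seq (int * int)) :=
  [set y : config A | forall p, p \in s -> y p = x p].
pose F : set_system (config A) := filter_from setT B.
have FF : Filter F.
  apply: filter_from_filter; first by exists [::].
  move=> s s' _ _; exists (s ++ s') => // y yss'; split=> p ps;
    by apply: yss'; rewrite mem_cat ps ?orbT.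
suff Fx : F --> x by move=> /Fx[s _ sU]; exists s.
apply/cvg_sup => p V /= [W [[W' _ <-] Wx] WV].
exists [:: p] => // y yx; apply: WV; rewrite /= yx ?inE //.
Qed.

Lemma seq_box (s : seq (int * int)) :
  exists N : nat, forall p, p \in s ->
    [/\ - N%:Z <= p.1 <= N%:Z & - N%:Z <= p.2 <= N%:Z].
Proof.
elim: s => [|[m n] s [N sN]]; first by exists 0%N.
exists (maxn N (maxn (absz m) (absz n))) => p; rewrite inE.
case/orP=> [/eqP->|/sN[]].
  by split=> /=; lia.
by split; lia.
Qed.

Lemma open_box {A : finType} (X : set (config A)) (U : set (subspace X))
    (x : config A) :
  open U -> X x -> U x -> exists N : nat, forall y : config A, X y ->
    (forall m n, - N%:Z <= m <= N%:Z -> - N%:Z <= n <= N%:Z ->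
       y (m, n) = x (m, n)) -> U y.
Proof.
move=> /open_subspaceP[V oV VU] Xx Ux.
have Vx : V x by have : (U `&` X) x by []; rewrite -VU => -[].
have [s sV] := nbhs_cylinder x V (open_nbhs_nbhs (conj oV Vx)).
have [N sN] := seq_box s; exists N => y Xy yx.
have : (V `&` X) y.
  by split=> //; apply: sV => -[m n] /sN[]; apply: yx.
by rewrite VU => -[].
Qed.

(** * From irreducibility to transitivity *)

(** The strip of height [2N+1] is [x] up to abscissa [N], the walk [f] up to
    [N + l] and from there on [y] translated by [2N + l]. Above the strip only
    the part to the right of [N + l] is prescribed, by [y]; below it only the
    part to the left of [N], by [x]. The rest is the union of an upper left and
    a lower right quadrant. *)
Lemma glue_strip {A : finType} (h v : rel A) (x y : int -> int -> A) (N l : nat)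
    (f : nat -> nat -> A) :
  square_completing h v -> square_completing v h ->
  admissible h v (fun _ _ => true) x -> admissible h v (fun _ _ => true) y ->
  (0 < l)%N ->
  (forall i, (i < N.*2.+1)%N -> f 0%N i = x N%:Z (i%:Z - N%:Z)) ->
  (forall i, (i < N.*2.+1)%N -> f l i = y (- N%:Z) (i%:Z - N%:Z)) ->
  (forall t i, (t < l)%N -> (i < N.*2.+1)%N -> h (f t i) (f t.+1 i)) ->
  (forall t i, (t <= l)%N -> (i.+1 < N.*2.+1)%N -> v (f t i) (f t i.+1)) ->
  exists z, [/\ admissible h v (fun _ _ => true) z,
    forall m n, m <= N%:Z -> - N%:Z <= n <= N%:Z -> z m n = x m n &
    forall m n, - N%:Z <= m -> - N%:Z <= n <= N%:Z ->
      z (m + (N.*2 + l)%N%:Z) n = y m n].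
Proof.
move=> sq sq' [xh xv] [yh yv] l0 f0 fl fh fv.
(* [b] is the abscissa from which [w] follows [y], and [p] the translation. *)
have [b bE] : exists b : int, b = (N + l)%N%:Z by exists (N + l)%N%:Z.
have [p pE] : exists p : int, p = (N.*2 + l)%N%:Z by exists (N.*2 + l)%N%:Z.
rewrite -pE.
pose w (m n : int) := if m <= N%:Z then x m n
  else if m < b then f (absz (m - N%:Z)%R) (absz (n + N%:Z)%R)
  else y (m - p) n.
have wx m n : m <= N%:Z -> w m n = x m n by rewrite /w => ->.
have wy m n : b <= m -> w m n = y (m - p) n.
  by move=> mp; rewrite /w !ifF //; lia.
have wf (t i : nat) m n : (t <= l)%N -> (i < N.*2.+1)%N ->
    m = N%:Z + t%:Z -> n = i%:Z - N%:Z -> w m n = f t i.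
  move=> tl iN -> ->; have [t0|t0] := posnP t.
    by rewrite wx t0 ?f0 // addr0.
  have [tb|tb] := ltnP t l; last first.
    have -> : t = l by lia.
    by rewrite wy ?fl // ?bE; first congr y; lia.
  by rewrite /w ifF ?ifT; first congr f; lia.
clearbody w.
pose U (m n : int) := (N%:Z < n) && (m < b).
pose L (m n : int) := (n < - N%:Z) && (N%:Z < m).
have UP m n : ~~ U m n -> n <= N%:Z \/ b <= m by rewrite /U; lia.
have LP m n : ~~ L m n -> - N%:Z <= n \/ m <= N%:Z by rewrite /L; lia.
have wadm : admissible h v (fun m n => ~~ U m n && ~~ L m n) w.
  split=> m n /andP[U1 L1] /andP[U2 L2].
    have [mN|mN] := boolP (m < N%:Z).
      by rewrite !wx; [apply: xh|lia..].
    have [mb|mb] := boolP (b <= m).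
      by rewrite !wy; [rewrite addrAC; apply: yh|lia..].
    have {U1 L2}[/LP ? /UP ?] := (L2, U1).
    have [t [i [? ? ? ?]]] : exists t i, [/\ (t < l)%N, (i < N.*2.+1)%N,
        m = N%:Z + t%:Z & n = i%:Z - N%:Z].
      by exists (absz (m - N%:Z)%R), (absz (n + N%:Z)%R); split; lia.
    by rewrite (wf t i) ?(wf t.+1 i); [apply: fh|lia..].
  have [mN|mN] := boolP (m <= N%:Z).
    by rewrite !wx //; apply: xv.
  have [mb|mb] := boolP (b <= m).
    by rewrite !wy //; apply: yv.
  have {U2 L1}[/LP ? /UP ?] := (L1, U2).
  have [t [i [? ? ? ?]]] : exists t i, [/\ (t < l)%N, (i.+1 < N.*2.+1)%N,
      m = N%:Z + t%:Z & n = i%:Z - N%:Z].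
    by exists (absz (m - N%:Z)%R), (absz (n + N%:Z)%R); split; lia.
  by rewrite (wf t i) ?(wf t i.+1); [apply: fv; lia|lia..].
have [|||z zw zadm] := completion h v U L (- (N%:Z + b)) w sq sq' _ _ _ wadm.
- by rewrite /U => m n Um; split; lia.
- by rewrite /L => m n Lm; split; lia.
- by move=> m n; rewrite /U /L; lia.
exists z; split=> // m n mN nN.
  by rewrite zw ?wx //; rewrite /U /L; lia.
by rewrite zw ?wy ?addrK //; rewrite /U /L; lia.
Qed.

(** Only positive times appear here: a negative time for [U] and [W] is
    a positive time for [W] and [U]. *)
Lemma irreducible_transitive {A : finType} (G : graph2 A)
    (U W : set (subspace (XG G))) :
  square_completing (hedge G) (vedge G) ->
  square_completing (vedge G) (hedge G) ->
  (forall k : nat, (0 < k)%N -> irreducible_mx (Hk G k)) ->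
  U `<=` XG G -> W `<=` XG G -> open U -> open W -> U !=set0 -> W !=set0 ->
  exists2 p : nat, (0 < p)%N & exists z : config A,
    U z /\ W (shift (p%:Z, 0) z).
Proof.
move=> sq sq' irr UX WX oU oW [x Ux] [y Wy].
have [Nx UN] := open_box _ _ _ oU (UX _ Ux) Ux.
have [Ny WN] := open_box _ _ _ oW (WX _ Wy) Wy.
pose N := maxn Nx Ny.
have /XG_admissible xadm := UX _ Ux; have /XG_admissible yadm := WX _ Wy.
pose a := x (0, 0).
have [c cE] : exists c : column G N.*2.+1, forall i, (i < N.*2.+1)%N ->
    nth a (val c) i = x (N%:Z, i%:Z - N%:Z).
  apply: column_of => i _.
  by have := xadm.2 N%:Z (i%:Z - N%:Z) isT isT; rewrite addrAC -PoszD addn1.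
have [d dE] : exists d : column G N.*2.+1, forall i, (i < N.*2.+1)%N ->
    nth a (val d) i = y (- N%:Z, i%:Z - N%:Z).
  apply: column_of => i _.
  by have := yadm.2 (- N%:Z) (i%:Z - N%:Z) isT isT; rewrite addrAC -PoszD addn1.
have [l l0 /(Hk_exp_neq0 _ _ a)[f [f0 fl fh fv]]] :=
  irr N.*2.+1 isT (enum_rank c) (enum_rank d).
have [|| z [zadm zx zy]] :=
  glue_strip _ _ _ _ N l f sq sq' xadm yadm l0 _ _ fh fv.
- by move=> i iN; rewrite f0 // cE.
- by move=> i iN; rewrite fl // dE.
pose z' : config A := fun p => z p.1 p.2.
have zG : XG G z' by apply/XG_admissible.
exists (N.*2 + l)%N; first by lia.
exists z'; split.
  by apply: UN => // m n mN nN; rewrite /z' /= zx //; lia.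
apply: WN => [|m n mN nN].
  move=> m n; have := zG (m + (N.*2 + l)%N%:Z) n.
  by rewrite /shift /z' /= !addr0 [m + 1 + _]addrAC.
by rewrite /shift /z' /= addr0 zy //; lia.
Qed.

(** * From transitivity to irreducibility *)

(** The column, placed at the origin, is prolonged from its top by steps
    right, up, right, up, and so on, and from its bottom by steps left, down,
    left, down. This monotone staircase separates the plane into an upper left
    and a lower right part, as [completion] requires. *)
Lemma column_in_XG {A : finType} (G : graph2 A) (k : nat) (a : A)
    (c : column G k) :
  square_completing (hedge G) (vedge G) ->
  square_completing (vedge G) (hedge G) ->
  essential G -> (0 < k)%N ->
  exists2 x : config A, XG G x &
    forall i : nat, (i < k)%N -> x (0, i%:Z) = nth a (val c) i.
Proof.
move=> sq sq' ess k0.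
have /choice[hs hsP] : forall b, exists c, hedge G b c.
  by move=> b; case: (ess b).
have /choice[hp hpP] : forall b, exists c, hedge G c b.
  by move=> b; case: (ess b).
have /choice[vs vsP] : forall b, exists c, vedge G b c.
  by move=> b; case: (ess b).
have /choice[vp vpP] : forall b, exists c, vedge G c b.
  by move=> b; case: (ess b).
(* [P t] and [hs (P t)] are the values at (t, t + k - 1) and at
   (t + 1, t + k - 1), while [Q t] and [hp (Q t)] are those at (-t, -t) and at
   (-t - 1, -t). *)
pose P t := iter t (vs \o hs) (nth a (val c) k.-1).
pose Q t := iter t (vp \o hp) (nth a (val c) 0).
pose w (m n : int) := if m == 0 then nth a (val c) (absz n)
  else if 0 < m then
    (if n == m + k%:Z - 1 then P (absz m) else hs (P (absz (m - 1)%R)))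
  else (if n == m then Q (absz m) else hp (Q (absz (m + 1)%R))).
pose U (m n : int) := (m < 0) && (m + 1 < n) || (0 <= m) && (m + k%:Z - 1 < n).
pose L (m n : int) := (m <= 0) && (n < m) || (0 < m) && (n < m + k%:Z - 2).
have w0 (i : nat) : w 0 i%:Z = nth a (val c) i by rewrite /w eqxx.
have wP (t : nat) : w t%:Z (t%:Z + k%:Z - 1) = P t.
  case: t => [|t]; last by rewrite /w /= eqxx.
  by rewrite (_ : 0 + k%:Z - 1 = k.-1%:Z) ?w0 //; lia.
have wP' (t : nat) : w t.+1%:Z (t%:Z + k%:Z - 1) = hs (P t).
  rewrite /w /= ifF; last by lia.
  by congr (hs (P _)); lia.
have wQ (t : nat) : w (- t%:Z) (- t%:Z) = Q t.
  case: t => [|t]; first by rewrite oppr0 w0.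
  by rewrite /w /= eqxx.
have wQ' (t : nat) : w (- t.+1%:Z) (- t%:Z) = hp (Q t).
  rewrite /w !ifF; [congr (hp (Q _))|..]; lia.
have wadm : admissible (hedge G) (vedge G)
    (fun m n => ~~ U m n && ~~ L m n) w.
  split=> m n /andP[U1 L1] /andP[U2 L2].
    have [m0|m0] := boolP (0 <= m).
      have -> : m = (absz m)%:Z by lia.
      have -> : n = (absz m)%:Z + k%:Z - 1.
        by move: U1 L1 U2 L2; rewrite /U /L; lia.
      by rewrite wP (_ : _ + 1 = (absz m).+1%:Z) ?wP'; [apply: hsP|lia].
    have [t tE] : exists t, absz m = t.+1 by exists (absz m).-1; lia.
    have -> : m = - t.+1%:Z by lia.
    have -> : n = - t%:Z by move: U1 L1 U2 L2; rewrite /U /L; lia.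
    by rewrite wQ' (_ : _ + 1 = - t%:Z) ?wQ; [apply: hpP|lia].
  have [m0|m0|m0] := ltgtP m 0.
  - have [t tE] : exists t, absz m = t.+1 by exists (absz m).-1; lia.
    have -> : m = - t.+1%:Z by lia.
    have -> : n = - t.+1%:Z by move: U1 L1 U2 L2; rewrite /U /L; lia.
    by rewrite wQ (_ : _ + 1 = - t%:Z) ?wQ'; [apply: vpP|lia].
  - have [t tE] : exists t, absz m = t.+1 by exists (absz m).-1; lia.
    have -> : m = t.+1%:Z by lia.
    have -> : n = t%:Z + k%:Z - 1.
      by move: U1 L1 U2 L2; rewrite /U /L; lia.
    by rewrite wP' (_ : _ + 1 = t.+1%:Z + k%:Z - 1) ?wP; [apply: vsP|lia].
  - have [i iE ik] : exists2 i : nat, n = i%:Z & (i.+1 < k)%N.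
      by exists (absz n); move: U1 L1 U2 L2; rewrite /U /L m0; lia.
    by rewrite m0 iE -PoszD addn1 !w0; apply: column_vedge.
have [|||x xw xadm] := completion _ _ U L (- k%:Z) w sq sq' _ _ _ wadm.
- by rewrite /U => m n Um; split; lia.
- by rewrite /L => m n Lm; split; lia.
- by move=> m n; rewrite /U /L; lia.
exists (fun p => x p.1 p.2); first exact/XG_admissible.
by move=> i ik; rewrite /= xw ?w0 //; rewrite /U /L; lia.
Qed.

Lemma transitive_irreducible {A : finType} (G : graph2 A) :
  square_completing (hedge G) (vedge G) ->
  square_completing (vedge G) (hedge G) ->
  essential G -> hor_doubly_transitive (XG G) ->
  forall k : nat, (0 < k)%N -> irreducible_mx (Hk G k).
Proof.
move=> sq sq' ess trans k k0 i j.
pose c : column G k := enum_val i; pose d : column G k := enum_val j.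
have a : A by exact: (tnth (val c) (Ordinal k0)).
have [x xG xc] := column_in_XG G k a c sq sq' ess k0.
have [y yG yd] := column_in_XG G k a d sq sq' ess k0.
pose s := [seq (0 : int, t%:Z) | t <- iota 0 k].
pose C (x : config A) := [set z : config A | forall p, p \in s -> z p = x p].
have sP t : (t < k)%N -> (0, t%:Z) \in s.
  by move=> tk; apply: map_f; rewrite mem_iota.
have oC x' : open (XG G `&` C x' : set (subspace (XG G))).
  apply/open_subspaceP; exists (C x'); first exact: open_cylinder.
  by rewrite setIAC setIid setIC.
have [||p [_ [p0 _ [_ [[z [zG zx] <-] [_ zy]]] _]]] :=
    trans _ _ (@subIsetl _ _ (C x)) (@subIsetl _ _ (C y)) (oC x) (oC y).
- by exists x; split.
- by exists y; split.
exists p => //.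
rewrite -[i]enum_valK -[j]enum_valK; apply/(Hk_exp_neq0 _ _ a).
exists (fun t i => z (t%:Z, i%:Z)).
split=> [l lk|l lk|t l tp lk|t l tp lk].
- by rewrite zx ?xc //; apply: sP.
- rewrite -yd // -zy; last exact: sP.
  by rewrite /shift; congr z; congr pair => /=; rewrite ?add0r ?addr0.
- by rewrite -addn1 PoszD; case: (zG t l).
- by rewrite -(addn1 l) PoszD; case: (zG t l).
Qed.

Theorem proposition7 (A : finType) (G : graph2 A)
  (XG_neq0 : XG G !=set0)
  (HV_VH : forall i j : 'I_#|A|,
    (Hmx G *m Vmx G) i j != 0 <-> (Vmx G *m Hmx G) i j != 0) :
  (essential G ->
    (hor_doubly_transitive (XG G) <->
     forall k : nat, (0 < k)%N -> irreducible_mx (Hk G k)))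
  /\
  ((forall k : nat, (0 < k)%N -> irreducible_mx (Hk G k)) ->
    hor_doubly_transitive (XG G)).
Proof.
have sq : square_completing (hedge G) (vedge G).
  by apply: square_completing_adjmx => i j; case: (HV_VH i j).
have sq' : square_completing (vedge G) (hedge G).
  by apply: square_completing_adjmx => i j; case: (HV_VH i j).
have irr_trans : (forall k : nat, (0 < k)%N -> irreducible_mx (Hk G k)) ->
    hor_doubly_transitive (XG G).
  move=> irr U W UX WX oU oW U0 W0.
  have [p p0 [z [Uz Wz]]] :=
    irreducible_transitive G U W sq sq' irr UX WX oU oW U0 W0.
  have [q q0 [y [Wy Uy]]] :=
    irreducible_transitive G W U sq sq' irr WX UX oW oU W0 U0.
  exists p, q; split=> //.
    by exists (shift (p%:Z, 0) z); split=> //; exists z.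
  exists y; split=> //; exists (shift (q%:Z, 0) y) => //.
  apply/funext => -[m n]; rewrite /shift; congr y; congr pair => /=.
    by rewrite addrNK.
  by rewrite !addr0.
split=> // ess; split=> // trans.
exact: transitive_irreducible.
Qed.
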